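(* Let $(H,\alpha)$ be a monoidal Hom-Hopf algebra over a commutative ring $k$. Then the category ${}^{H}_{H}\widetilde{\mathcal{H}}(\mathcal{M}_k)_{H}$ of left-covariant $(H,\alpha)$-Hom-bimodules forms a monoidal category, with unit object $(H,\alpha)$, tensor product $(M\otimes_HN,\mu\otimes_H\nu)$ of $(M,\mu)$ and $(N,\nu)$ with structure maps $$h(m\otimes_Hn)=\alpha^{-1}(h)m\otimes_H\nu(n),\quad(m\otimes_Hn)h=\mu(m)\otimes_Hn\alpha^{-1}(h),\quad\rho(m\otimes_Hn)=m_{(-1)}n_{(-1)}\otimes(m_{(0)}\otimes_Hn_{(0)}),$$ associativity constraint $\tilde a_{M,N,P}((m\otimes_Hn)\otimes_Hp)=\mu(m)\otimes_H(n\otimes_H\pi^{-1}(p))$ (for $(P,\pi)$), left unit constraint $\tilde l_M:H\otimes_HM\to M$, $h\otimes_Hm\mapsto hm$, and right unit constraint $\tilde r_M:M\otimes_HH\to M$, $m\otimes_Hh\mapsto mh$.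
   Context: Conventions: $k$ is a commutative ring, $\otimes=\otimes_k$, Sweedler notation without summation signs. $\widetilde{\mathcal{H}}(\mathcal{M}_k)$ is the category of pairs $(M,\mu)$, $M$ a $k$-module, $\mu$ a $k$-linear automorphism of $M$; morphisms $f:(M,\mu)\to(N,\nu)$ are $k$-linear maps with $\nu f=f\mu$; $(M,\mu)\otimes(N,\nu)=(M\otimes N,\mu\otimes\nu)$. A monoidal Hom-Hopf algebra $(H,\alpha)$ is an object of $\widetilde{\mathcal{H}}(\mathcal{M}_k)$ with a $k$-bilinear product, an element $1_H$, and $k$-linear maps $\Delta(h)=h_1\otimes h_2$, $\varepsilon:H\to k$, $S:H\to H$ (antipode) such that $\alpha(ab)=\alpha(a)\alpha(b)$, $\alpha(1_H)=1_H$, $\alpha(a)(bc)=(ab)\alpha(c)$, $a1_H=1_Ha=\alpha(a)$; $\Delta(\alpha(c))=\alpha(c_1)\otimes\alpha(c_2)$, $\varepsilon\alpha=\varepsilon$, $\alpha^{-1}(c_1)\otimes\Delta(c_2)=c_{11}\otimes(c_{12}\otimes\alpha^{-1}(c_2))$, $c_1\varepsilon(c_2)=\alpha^{-1}(c)=\varepsilon(c_1)c_2$; $\Delta(ab)=\Delta(a)\Delta(b)$, $\Delta(1_H)=1_H\otimes1_H$, $\varepsilon(ab)=\varepsilon(a)\varepsilon(b)$, $\varepsilon(1_H)=1$; $S\alpha=\alpha S$ and $S(h_1)h_2=\varepsilon(h)1_H=h_1S(h_2)$. All actions and coactions are morphisms in $\widetilde{\mathcal{H}}(\mathcal{M}_k)$.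 Hom-bimodule $(M,\mu)$: $\alpha(g)(hm)=(gh)\mu(m)$, $1_Hm=\mu(m)$, $(mg)\alpha(h)=\mu(m)(gh)$, $m1_H=\mu(m)$, $(gm)\alpha(h)=\alpha(g)(mh)$. Left Hom-comodule, $\rho(m)=m_{(-1)}\otimes m_{(0)}$: $\Delta(m_{(-1)})\otimes\mu^{-1}(m_{(0)})=(\alpha^{-1}(m_{(-1)})\otimes m_{(0)(-1)})\otimes m_{(0)(0)}$, $\varepsilon(m_{(-1)})m_{(0)}=\mu^{-1}(m)$. A left-covariant $(H,\alpha)$-Hom-bimodule is a Hom-bimodule with a left Hom-coaction $\rho$ such that $\rho((hm)\alpha(g))=\Delta(\alpha(h))(\rho(m)\Delta(g))$ (componentwise actions). Morphisms are morphisms in $\widetilde{\mathcal{H}}(\mathcal{M}_k)$ that are $H$-linear on both sides and left $H$-colinear. $(H,\alpha)$ is a left-covariant Hom-bimodule via its product and coproduct. For a right Hom-module $(M,\mu)$ and left Hom-module $(N,\nu)$, $M\otimes_HN$ is the coequalizer of $(m\otimes h)\otimes n\mapsto mh\otimes n$ and $(m\otimes h)\otimes n\mapsto\mu(m)\otimes h\nu^{-1}(n)$, i.e. the quotient of $M\otimes N$ by the relations $mh\otimes n=\mu(m)\otimes h\nu^{-1}(n)$. *)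

(* Defs.v *)
From HB Require Import structures.
From mathcomp Require Import all_boot all_algebra.
From mathcomp Require Import boolp classical_sets functions fsbigop.

Set Implicit Arguments.
Unset Strict Implicit.
Unset Printing Implicit Defensive.

Import GRing.Theory.
Local Open Scope ring_scope.
Local Open Scope quotient_scope.

Section Linear.
Variables (k : pzRingType) (U V : lmodType k).

Definition mklin (f : U -> V) (fl : linear f) : {linear U -> V} :=
  HB.pack f (GRing.isLinear.Build k U V *:%R f fl).

Lemma linear_eqP (f g : {linear U -> V}) : f =1 g -> f = g.
Proof.
case: f => f [[f1] [f2]]; case: g => g [[g1] [g2]] /= /funext fg; subst g.
by rewrite (Prop_irrelevance f1 g1) (Prop_irrelevance f2 g2).
Qed.
End Linear.

(* The free module on X: finitely supported functions X -> k. *)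
Section FreeModule.
Variables (k : pzRingType) (X : choiceType).

Definition finsupp : {pred X -> k^o} :=
  fun f => `[< exists r : seq X, forall x, x \notin r -> f x = 0 >].

Lemma finsupp_submod : submod_closed finsupp.
Proof.
split; first by apply/asboolP; exists [::].
move=> a f g /asboolP [r Hr] /asboolP [s Hs]; apply/asboolP.
exists (r ++ s) => x; rewrite mem_cat negb_or => /andP [xr xs].
by rewrite /GRing.add /GRing.scale /= Hr // Hs // scaler0 addr0.
Qed.

HB.instance Definition _ :=
  GRing.isSubmodClosed.Build k (X -> k^o) finsupp finsupp_submod.

Record freemod := Freemod {
  freemod_val :> X -> k^o;
  freemod_valP : freemod_val \in finsupp }.

HB.instance Definition _ := [isSub for freemod_val].
HB.instance Definition _ := [Choice of freemod by <:].
HB.instance Definition _ := [SubChoice_isSubLmodule of freemod by <:].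

Lemma fdelta_subproof (x : X) :
  (fun y => (y == x)%:R : k^o) \in finsupp.
Proof.
by apply/asboolP; exists [:: x] => y; rewrite inE => /negPf ->.
Qed.

Definition fdelta (x : X) : freemod := Freemod (fdelta_subproof x).

Variables (V : lmodType k) (phi : X -> V).

Definition fsum (f : freemod) : V := \sum_(x \in [set: X]) (f x : k) *: phi x.

Lemma fsumE (f : freemod) (r : seq X) : uniq r ->
  (forall x, x \notin r -> f x = 0) -> fsum f = \sum_(x <- r) (f x : k) *: phi x.
Proof.
move=> ur Hr; rewrite /fsum; symmetry; rewrite (@bigfs _ _ _ _ r predT) //.
  by apply: eq_fsbigl; apply/seteqP; split.
by move=> x _ xr; rewrite Hr // scale0r.
Qed.

Lemma freemod_fin (f : freemod) :
  exists r : seq X, forall x, x \notin r -> f x = 0.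
Proof. by have /asboolP := freemod_valP f. Qed.

Lemma fsum_linear : linear fsum.
Proof.
move=> a f g; have [r Hr] := freemod_fin f; have [s Hs] := freemod_fin g.
pose t := undup (r ++ s).
have ut : uniq t by rewrite undup_uniq.
have Hf x : x \notin t -> f x = 0.
  by rewrite mem_undup mem_cat negb_or => /andP [xr _]; apply: Hr.
have Hg x : x \notin t -> g x = 0.
  by rewrite mem_undup mem_cat negb_or => /andP [_ xs]; apply: Hs.
rewrite (fsumE ut Hf) (fsumE ut Hg) (@fsumE _ t) //.
  rewrite scaler_sumr -big_split /=; apply: eq_bigr => x _.
  by rewrite scalerA -scalerDl.
by move=> x xt; have /= -> : (a *: f + g) x = a *: f x + g x by [];
  rewrite Hf // Hg // scaler0 addr0.
Qed.

Definition flift : {linear freemod -> V} := mklin fsum_linear.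

Lemma flift_delta x : flift (fdelta x) = phi x.
Proof.
rewrite /flift /= (@fsumE _ [:: x]) //.
  by rewrite big_seq1 /= eqxx scale1r.
by move=> y; rewrite inE /= => /negPf ->.
Qed.

End FreeModule.

Lemma freemod_ind (k : pzRingType) (X : choiceType) (P : freemod k X -> Prop) :
  P 0 -> (forall a x f, P f -> P (a *: fdelta k x + f)) -> forall f, P f.
Proof.
move=> P0 PD f; have [r Hr] := freemod_fin f.
have -> : f = \sum_(x <- undup r) (f x : k) *: fdelta k x.
  apply/val_inj/funext => y.
  have -> : val (\sum_(x <- undup r) (f x : k) *: fdelta k x) y
            = \sum_(x <- undup r) (f x : k) *: (fdelta k x y : k^o).
    elim: (undup r) => [|x s IH]; first by rewrite !big_nil.
    by rewrite !big_cons -IH.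
  have [yr|yr] := boolP (y \in undup r); last first.
    rewrite [RHS]big_seq [RHS]big1 => [|x xr /=].
      by apply: Hr; rewrite -mem_undup.
    by case: eqP => [yx|_]; [rewrite yx xr in yr | rewrite scaler0].
  rewrite (bigD1_seq y) ?undup_uniq //= eqxx big1 ?addr0.
    by rewrite /GRing.scale /= mulr1.
  by move=> x /negPf xy; rewrite eq_sym xy scaler0.
elim: (undup r) => [|x s IH]; first by rewrite big_nil.
by rewrite big_cons; apply: PD.
Qed.

(* The quotient of V by the submodule spanned by the elements satisfying G. *)
Section QuotientModule.
Variables (k : pzRingType) (V : lmodType k) (G : V -> Prop).

Inductive span : V -> Prop :=
| span_0 : span 0
| span_D a u v : G u -> span v -> span (a *: u + v).

Definition spanb : {pred V} := fun v => `[< span v >].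

Lemma spanb_submod : submod_closed spanb.
Proof.
split; first exact/asboolP/span_0.
move=> a u v /asboolP su /asboolP sv; apply/asboolP.
elim: su => [|b w w' Gw _ IH]; first by rewrite scaler0 add0r.
by rewrite scalerDr scalerA -addrA; apply: span_D.
Qed.

HB.instance Definition _ := GRing.isSubmodClosed.Build k V spanb spanb_submod.

Definition quotm := Quotient.quot spanb.
HB.instance Definition _ := GRing.Zmodule.on quotm.

Lemma qpi_eqP (u v : V) : reflect (\pi_quotm u = \pi_quotm v) (u - v \in spanb).
Proof. by rewrite Quotient.idealrBE; exact: eqP. Qed.

Lemma qpi_surj (q : quotm) : exists v, q = \pi_quotm v.
Proof. by exists (repr q); rewrite reprK. Qed.

Definition qscale (a : k) (q : quotm) : quotm := \pi_quotm (a *: repr q).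

Lemma qscaleE a v : qscale a (\pi_quotm v) = \pi_quotm (a *: v).
Proof.
apply/qpi_eqP; rewrite -scalerBr rpredZ //; apply/qpi_eqP.
by rewrite reprK.
Qed.

Lemma qpiD u v : \pi_quotm (u + v) = \pi_quotm u + \pi_quotm v.
Proof. by rewrite !piE. Qed.

Fact qscaleA a b q : qscale a (qscale b q) = qscale (a * b) q.
Proof. by case: (qpi_surj q) => v ->; rewrite !qscaleE scalerA. Qed.
Fact qscale1 : left_id 1 qscale.
Proof. by move=> q; case: (qpi_surj q) => v ->; rewrite qscaleE scale1r. Qed.
Fact qscaleDr : right_distributive qscale +%R.
Proof.
move=> a p q; case: (qpi_surj p) => u ->; case: (qpi_surj q) => v ->.
by rewrite -qpiD !qscaleE scalerDr qpiD.
Qed.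
Fact qscaleDl q : {morph qscale^~ q : a b / a + b}.
Proof.
by move=> a b; case: (qpi_surj q) => v ->; rewrite !qscaleE scalerDl qpiD.
Qed.

HB.instance Definition _ :=
  GRing.Zmodule_isLmodule.Build k quotm qscaleA qscale1 qscaleDr qscaleDl.

Fact qpi_linear : linear (\pi_quotm : V -> quotm).
Proof. by move=> a u v; rewrite qpiD -qscaleE. Qed.

End QuotientModule.

(* The maps below are locked: unification would otherwise unfold them down to
   representatives of equivalence classes. *)
HB.lock Definition qpi (k : pzRingType) (V : lmodType k) (G : V -> Prop) :
  {linear V -> quotm G} := mklin (@qpi_linear k V G).

Section QuotientTheory.
Variables (k : pzRingType) (V : lmodType k) (G : V -> Prop).
Local Notation quotm := (quotm G).
Local Notation spanb := (spanb G).
Local Notation qpi := (qpi G).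

Lemma qpiE v : qpi v = \pi_quotm v.
Proof. by rewrite qpi.unlock. Qed.

Lemma qpiW (P : quotm -> Prop) : (forall v, P (qpi v)) -> forall q, P q.
Proof. by move=> PG q; case: (qpi_surj q) => v ->; rewrite -qpiE. Qed.

Lemma qpi_rel u v : G (u - v) -> qpi u = qpi v.
Proof.
move=> Guv; rewrite !qpiE; apply/qpi_eqP/asboolP; rewrite -[_ - _]addr0 -[u - v]scale1r.
by apply: span_D => //; apply: span_0.
Qed.

Variables (W : lmodType k) (f : {linear V -> W}).
Hypothesis fG : forall v, G v -> f v = 0.

Lemma spanb_ker u v : u - v \in spanb -> f u = f v.
Proof.
move=> /asboolP s; apply/eqP; rewrite -subr_eq0 -linearB /=; apply/eqP.
elim: s => [|a x y Gx _ IH]; first exact: linear0.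
by rewrite linearP fG // scaler0 add0r.
Qed.

Lemma qlift_repr v : f (repr (qpi v)) = f v.
Proof. by apply/spanb_ker/qpi_eqP; rewrite reprK qpiE. Qed.

Fact qlift_linear : linear (fun q : quotm => f (repr q)).
Proof.
by move=> a; elim/qpiW => u; elim/qpiW => v; rewrite -linearP !qlift_repr linearP.
Qed.

End QuotientTheory.

HB.lock Definition qlift (k : pzRingType) (V : lmodType k) (G : V -> Prop)
    (W : lmodType k) (f : {linear V -> W}) (fG : forall v, G v -> f v = 0) :
  {linear quotm G -> W} := mklin (qlift_linear fG).

Lemma qliftE (k : pzRingType) (V : lmodType k) (G : V -> Prop)
    (W : lmodType k) (f : {linear V -> W}) (fG : forall v, G v -> f v = 0) v :
  qlift fG (qpi G v) = f v.
Proof. by rewrite qlift.unlock; exact: qlift_repr. Qed.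

Section Tensor.
Variables (k : comPzRingType) (M N : lmodType k).

Local Notation d := (fdelta k).

Inductive tensor_rel : freemod k (M * N)%type -> Prop :=
| trel_Dl m m' n : tensor_rel (d (m + m', n) - (d (m, n) + d (m', n)))
| trel_Dr m n n' : tensor_rel (d (m, n + n') - (d (m, n) + d (m, n')))
| trel_Zl a m n : tensor_rel (d (a *: m, n) - a *: d (m, n))
| trel_Zr a m n : tensor_rel (d (m, a *: n) - a *: d (m, n)).

Definition tensor : lmodType k := quotm tensor_rel.

End Tensor.

HB.lock Definition pure (k : comPzRingType) (M N : lmodType k) (m : M) (n : N) :
  tensor M N := qpi (@tensor_rel k M N) (fdelta k (m, n)).

Notation "m ⊗ n" := (pure m n) (at level 40, left associativity).

Section TensorTheory.
Variables (k : comPzRingType) (M N : lmodType k).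

Local Notation d := (fdelta k).
Local Notation tensor := (tensor M N).
Local Notation tensor_rel := (@tensor_rel k M N).
Local Notation pure := (@pure k M N).
Implicit Types (m : M) (n : N).

Lemma pureE m n : pure m n = qpi tensor_rel (d (m, n)).
Proof. by rewrite pure.unlock. Qed.

Lemma pure_linearl n : linear (pure^~ n).
Proof.
move=> a m m'; rewrite !pureE (qpi_rel (trel_Dl _ _ _)) linearD.
by rewrite (qpi_rel (trel_Zl _ _ _)) linearZ.
Qed.

Lemma pure_linearr m : linear (pure m).
Proof.
move=> a n n'; rewrite !pureE (qpi_rel (trel_Dr _ _ _)) linearD.
by rewrite (qpi_rel (trel_Zr _ _ _)) linearZ.
Qed.

Lemma pureDl m m' n : (m + m') ⊗ n = m ⊗ n + m' ⊗ n.
Proof. exact: (linearD (mklin (pure_linearl n))). Qed.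
Lemma pureDr m n n' : m ⊗ (n + n') = m ⊗ n + m ⊗ n'.
Proof. exact: (linearD (mklin (pure_linearr m))). Qed.
Lemma pureZl a m n : (a *: m) ⊗ n = a *: (m ⊗ n).
Proof. exact: (linearZ_LR (mklin (pure_linearl n))). Qed.
Lemma pureZr a m n : m ⊗ (a *: n) = a *: (m ⊗ n).
Proof. exact: (linearZ_LR (mklin (pure_linearr m))). Qed.
Lemma pure0l n : 0 ⊗ n = 0 :> tensor.
Proof. exact: (linear0 (mklin (pure_linearl n))). Qed.
Lemma pure0r m : m ⊗ 0 = 0 :> tensor.
Proof. exact: (linear0 (mklin (pure_linearr m))). Qed.

Lemma tensor_ind (P : tensor -> Prop) :
  P 0 -> (forall m n t, P t -> P (pure m n + t)) -> forall t, P t.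
Proof.
move=> P0 PD; elim/qpiW; elim/freemod_ind => [|a [m n] f IH].
  by rewrite linear0.
have -> : qpi tensor_rel (a *: d (m, n) + f)
          = pure (a *: m) n + qpi tensor_rel f.
  by rewrite linearP pureE (qpi_rel (trel_Zl _ _ _)) linearZ.
exact: PD.
Qed.

Lemma tensor_linearP (W : lmodType k) (f g : {linear tensor -> W}) :
  (forall m n, f (pure m n) = g (pure m n)) -> f =1 g.
Proof.
move=> fg; elim/tensor_ind => [|m n t IH]; first by rewrite !linear0.
by rewrite !linearD fg IH.
Qed.

Variables (W : lmodType k) (b : M -> N -> W).
Hypotheses (bl : forall n, linear (b^~ n)) (br : forall m, linear (b m)).

Lemma tlift_subproof t :
  tensor_rel t -> flift (fun p : M * N => b p.1 p.2) t = 0.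
Proof.
have bl0 n : b 0 n = 0.
  by have := bl n (-1) 0 0; rewrite scaler0 addr0 scaleN1r addNr.
have br0 m : b m 0 = 0.
  by have := br m (-1) 0 0; rewrite scaler0 addr0 scaleN1r addNr.
case=> [m m' n|m n n'|a m n|a m n];
  rewrite linearB; apply/eqP; rewrite subr_eq0; apply/eqP;
  rewrite ?linearD ?linearZ !flift_delta /=.
- by have := bl n 1 m m'; rewrite !scale1r.
- by have := br m 1 n n'; rewrite !scale1r.
- by have := bl n a m 0; rewrite !addr0 bl0 addr0.
- by have := br m a n 0; rewrite !addr0 br0 addr0.
Qed.

End TensorTheory.

HB.lock Definition tlift (k : comPzRingType) (M N W : lmodType k) (b : M -> N -> W)
    (bl : forall n, linear (b^~ n)) (br : forall m, linear (b m)) :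
  {linear tensor M N -> W} := qlift (tlift_subproof bl br).
Arguments tlift {k M N W} b bl br.

Lemma tliftE (k : comPzRingType) (M N W : lmodType k) (b : M -> N -> W)
    (bl : forall n, linear (b^~ n)) (br : forall m, linear (b m)) m n :
  tlift b bl br (m ⊗ n) = b m n.
Proof. by rewrite tlift.unlock pureE qliftE flift_delta. Qed.

HB.lock Definition tmap (k : comPzRingType) (A B C D : lmodType k)
    (f : {linear A -> C}) (g : {linear B -> D}) :
    {linear tensor A B -> tensor C D} :=
  tlift (fun a b => f a ⊗ g b)
    (fun b => linearP (mklin (pure_linearl (g b)) \o f))
    (fun a => linearP (mklin (pure_linearr (f a)) \o g)).

Lemma tmapE (k : comPzRingType) (A B C D : lmodType k)
    (f : {linear A -> C}) (g : {linear B -> D}) a b :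
  tmap f g (a ⊗ b) = f a ⊗ g b.
Proof. by rewrite tmap.unlock tliftE. Qed.

HB.lock Definition tswap (k : comPzRingType) (A B : lmodType k) :
    {linear tensor A B -> tensor B A} :=
  tlift (fun a b => b ⊗ a) (fun b => @pure_linearr k B A b)
    (fun a => @pure_linearl k B A a).

Lemma tswapE (k : comPzRingType) (A B : lmodType k) (a : A) (b : B) :
  tswap A B (a ⊗ b) = b ⊗ a.
Proof. by rewrite tswap.unlock tliftE. Qed.

Section Tassoc.
Variables (k : comPzRingType) (A B C : lmodType k).

Fact tassoc_aux_linearr c (a : A) : linear (fun b : B => a ⊗ (b ⊗ c : tensor B C)).
Proof. by move=> x b b'; rewrite pure_linearl pure_linearr. Qed.

Definition tassoc_aux (c : C) : {linear tensor A B -> tensor A (tensor B C)} :=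
  tlift (fun a b => a ⊗ (b ⊗ c))
    (fun b => @pure_linearl k A (tensor B C) (b ⊗ c)) (tassoc_aux_linearr c).

Lemma tassoc_auxE c a b : tassoc_aux c (a ⊗ b) = a ⊗ (b ⊗ c).
Proof. exact: tliftE. Qed.

Fact tassoc_linearr t : linear (fun c => tassoc_aux c t).
Proof.
move=> x c c'; elim/tensor_ind: t => [|a b t IH].
  by rewrite !linear0 addr0.
rewrite !linearD IH !tassoc_auxE !pure_linearr.
exact: addrACA.
Qed.
End Tassoc.

HB.lock Definition tassoc (k : comPzRingType) (A B C : lmodType k) :
    {linear tensor (tensor A B) C -> tensor A (tensor B C)} :=
  tlift (fun t c => tassoc_aux A B c t) (fun c => linearP (tassoc_aux A B c))
    (@tassoc_linearr k A B C).

Lemma tassocE (k : comPzRingType) (A B C : lmodType k) (a : A) (b : B) (c : C) :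
  tassoc A B C (a ⊗ b ⊗ c) = a ⊗ (b ⊗ c).
Proof. by rewrite tassoc.unlock tliftE tassoc_auxE. Qed.

HB.lock Definition tassocV (k : comPzRingType) (A B C : lmodType k) :
    {linear tensor A (tensor B C) -> tensor (tensor A B) C} :=
  tswap C (tensor A B) \o tmap idfun (tswap B A) \o tassoc C B A
    \o tswap A (tensor C B) \o tmap idfun (tswap B C).

Lemma tassocVE (k : comPzRingType) (A B C : lmodType k) (a : A) (b : B) (c : C) :
  tassocV A B C (a ⊗ (b ⊗ c)) = a ⊗ b ⊗ c.
Proof. by rewrite tassocV.unlock /= !(tmapE, tswapE, tassocE). Qed.

(* (a ⊗ b) ⊗ (c ⊗ d) |-> (a ⊗ c) ⊗ (b ⊗ d) *)
HB.lock Definition tmid (k : comPzRingType) (A B C D : lmodType k) :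
    {linear tensor (tensor A B) (tensor C D) -> tensor (tensor A C) (tensor B D)} :=
  tassocV A C (tensor B D)
    \o tmap idfun (tassoc C B D \o tmap (tswap B C) idfun \o tassocV B C D)
    \o tassoc A B (tensor C D).

Lemma tmidE (k : comPzRingType) (A B C D : lmodType k)
    (a : A) (b : B) (c : C) (d : D) :
  tmid A B C D (a ⊗ b ⊗ (c ⊗ d)) = a ⊗ c ⊗ (b ⊗ d).
Proof.
by rewrite tmid.unlock /= tassocE tmapE /= tassocVE tmapE tswapE tassocE tassocVE.
Qed.

Section Contraction.
Variables (k : comPzRingType) (A B : lmodType k) (e : {linear A -> k^o}).

Fact contrl_linearl (b : B) : linear (fun a => (e a : k) *: b).
Proof. by move=> c a a'; rewrite linearP scalerDl -scalerA. Qed.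
Fact contrl_linearr a : linear (fun b : B => (e a : k) *: b).
Proof. by move=> c b b'; rewrite scalerDr !scalerA mulrC. Qed.
End Contraction.

(* a ⊗ b |-> e(a) b *)
HB.lock Definition contrl (k : comPzRingType) (A B : lmodType k)
    (e : {linear A -> k^o}) : {linear tensor A B -> B} :=
  tlift (fun a b => (e a : k) *: b) (contrl_linearl e) (contrl_linearr e).

Lemma contrlE (k : comPzRingType) (A B : lmodType k) (e : {linear A -> k^o})
    (a : A) (b : B) : contrl B e (a ⊗ b) = (e a : k) *: b.
Proof. by rewrite contrl.unlock tliftE. Qed.

(* b ⊗ a |-> e(a) b *)
Definition contrr (k : comPzRingType) (A B : lmodType k)
    (e : {linear A -> k^o}) : {linear tensor B A -> B} := contrl B e \o tswap B A.

Lemma contrrE (k : comPzRingType) (A B : lmodType k) (e : {linear A -> k^o})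
    (a : A) (b : B) : contrr B e (b ⊗ a) = (e a : k) *: b.
Proof. by rewrite /contrr /= tswapE contrlE. Qed.

(* Objects (M, μ) of H~(M_k); the inverse of μ, which μ determines, is kept as a
   component. *)
Record homMod (k : comPzRingType) := HomMod {
  hcar :> lmodType k;
  haut : {linear hcar -> hcar};
  hautV : {linear hcar -> hcar};
  hautK : cancel haut hautV;
  hautVK : cancel hautV haut }.

Arguments haut {k} _.
Arguments hautV {k} _.

(* A bilinear product is given as a linear map on H ⊗ H, the actions below as
   linear maps on H ⊗ M and M ⊗ H, and identities in Sweedler notation as
   identities between composites of linear maps. *)
Record homHopf (k : comPzRingType) := HomHopf {
  hopf_mod :> homMod k;
  hmul : {linear tensor hopf_mod hopf_mod -> hopf_mod};
  hone : hopf_mod;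
  hcomul : {linear hopf_mod -> tensor hopf_mod hopf_mod};
  hcounit : {linear hopf_mod -> k^o};
  hantip : {linear hopf_mod -> hopf_mod};
  haut_mul : forall a b,
    haut hopf_mod (hmul (a ⊗ b)) = hmul (haut hopf_mod a ⊗ haut hopf_mod b);
  haut_one : haut hopf_mod hone = hone;
  hmulA : forall a b c,
    hmul (haut hopf_mod a ⊗ hmul (b ⊗ c)) = hmul (hmul (a ⊗ b) ⊗ haut hopf_mod c);
  hmul1r : forall a, hmul (a ⊗ hone) = haut hopf_mod a;
  hmul1l : forall a, hmul (hone ⊗ a) = haut hopf_mod a;
  hcomul_aut : forall c,
    hcomul (haut hopf_mod c) = tmap (haut hopf_mod) (haut hopf_mod) (hcomul c);
  hcounit_aut : forall c, hcounit (haut hopf_mod c) = hcounit c;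
  hcomulA : forall c,
    tmap (hautV hopf_mod) hcomul (hcomul c)
    = tassoc _ _ _ (tmap hcomul (hautV hopf_mod) (hcomul c));
  hcounitr : forall c, contrr hopf_mod hcounit (hcomul c) = hautV hopf_mod c;
  hcounitl : forall c, contrl hopf_mod hcounit (hcomul c) = hautV hopf_mod c;
  hcomul_mul : forall a b,
    hcomul (hmul (a ⊗ b)) = tmap hmul hmul (tmid _ _ _ _ (hcomul a ⊗ hcomul b));
  hcomul_one : hcomul hone = hone ⊗ hone;
  hcounit_mul : forall a b,
    hcounit (hmul (a ⊗ b)) = (hcounit a : k) * (hcounit b : k);
  hcounit_one : hcounit hone = 1;
  hantip_aut : forall h, hantip (haut hopf_mod h) = haut hopf_mod (hantip h);
  hantipl : forall h, hmul (tmap hantip idfun (hcomul h)) = (hcounit h : k) *: hone;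
  hantipr : forall h, hmul (tmap idfun hantip (hcomul h)) = (hcounit h : k) *: hone }.

Arguments hmul {k} _.
Arguments hone {k} _.
Arguments hcomul {k} _.
Arguments hcounit {k} _.
Arguments hantip {k} _.

Section LeftCovariant.
Variables (k : comPzRingType) (H : homHopf k).
Local Notation α := (haut H).
Local Notation mulH := (hmul H).
Local Notation "1H" := (hone H).
Local Notation Δ := (hcomul H).

Section OnObject.
Variables (M : homMod k) (l : {linear tensor H M -> M})
  (r : {linear tensor M H -> M}) (rho : {linear M -> tensor H M}).
Local Notation μ := (haut M).

Definition is_hom_bimodule : Prop :=
  [/\ [/\ forall h m, μ (l (h ⊗ m)) = l (α h ⊗ μ m),
          forall g h m, l (α g ⊗ l (h ⊗ m)) = l (mulH (g ⊗ h) ⊗ μ m)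
        & forall m, l (1H ⊗ m) = μ m],
      [/\ forall m h, μ (r (m ⊗ h)) = r (μ m ⊗ α h),
          forall m g h, r (r (m ⊗ g) ⊗ α h) = r (μ m ⊗ mulH (g ⊗ h))
        & forall m, r (m ⊗ 1H) = μ m]
    & forall g m h, r (l (g ⊗ m) ⊗ α h) = l (α g ⊗ r (m ⊗ h))].

Definition is_left_hom_comodule : Prop :=
  [/\ forall m, rho (μ m) = tmap α μ (rho m),
      forall m, tmap Δ (hautV M) (rho m)
                = tassocV _ _ _ (tmap (hautV H) rho (rho m))
    & forall m, contrl M (hcounit H) (rho m) = hautV M m].

(* The componentwise actions of H ⊗ H on H ⊗ M. *)
Definition lact2 (x : tensor H H) (y : tensor H M) : tensor H M :=
  tmap mulH l (tmid _ _ _ _ (x ⊗ y)).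
Definition ract2 (y : tensor H M) (x : tensor H H) : tensor H M :=
  tmap mulH r (tmid _ _ _ _ (y ⊗ x)).

Definition is_left_covariant : Prop :=
  [/\ is_hom_bimodule, is_left_hom_comodule
    & forall h m g, rho (r (l (h ⊗ m) ⊗ α g))
                    = lact2 (Δ (α h)) (ract2 (rho m) (Δ g))].
End OnObject.

Record lcov_struct (M : homMod k) := LcovStruct {
  slact : {linear tensor H M -> M};
  sract : {linear tensor M H -> M};
  scoact : {linear M -> tensor H M};
  slcovP : is_left_covariant slact sract scoact }.

Record lcovBimod := LcovBimod {
  lcov_mod :> homMod k;
  lcov_str : lcov_struct lcov_mod }.

Definition lact (M : lcovBimod) := slact (lcov_str M).
Definition ract (M : lcovBimod) := sract (lcov_str M).
Definition coact (M : lcovBimod) := scoact (lcov_str M).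

Record lcovHom (M N : lcovBimod) := LcovHom {
  lcov_fun :> {linear M -> N};
  lcov_aut : forall m, haut N (lcov_fun m) = lcov_fun (haut M m);
  lcov_lact : forall h m, lcov_fun (lact M (h ⊗ m)) = lact N (h ⊗ lcov_fun m);
  lcov_ract : forall m h, lcov_fun (ract M (m ⊗ h)) = ract N (lcov_fun m ⊗ h);
  lcov_coact : forall m, coact N (lcov_fun m) = tmap idfun lcov_fun (coact M m) }.

Lemma lcovHom_eqP M N (f g : lcovHom M N) : f =1 g -> f = g.
Proof.
case: f => f f1 f2 f3 f4; case: g => g g1 g2 g3 g4 /= /linear_eqP fg; subst g.
by congr LcovHom; exact: Prop_irrelevance.
Qed.

Lemma tmap_id (A B : lmodType k) : tmap (@idfun A) (@idfun B) =1 idfun.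
Proof. by apply: tensor_linearP => a b; rewrite tmapE. Qed.

Lemma tmap_comp (A B C A' B' C' : lmodType k) (g : {linear B -> C})
  (f : {linear A -> B}) (g' : {linear B' -> C'}) (f' : {linear A' -> B'}) t :
  tmap g g' (tmap f f' t) = tmap (g \o f) (g' \o f') t.
Proof.
apply: (tensor_linearP (f := tmap g g' \o tmap f f')) => a b.
by rewrite /= !tmapE.
Qed.

Definition lcov_id (M : lcovBimod) : lcovHom M M.
Proof. by exists idfun => // m; rewrite tmap_id. Defined.

Definition lcov_comp (M N P : lcovBimod) (g : lcovHom N P) (f : lcovHom M N) :
  lcovHom M P.
Proof.
exists (g \o f) => [m|h m|m h|m] /=.
- by rewrite !lcov_aut.
- by rewrite !lcov_lact.
- by rewrite !lcov_ract.
rewrite !lcov_coact tmap_comp; move: (coact M m).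
by apply: tensor_linearP => h x; rewrite !tmapE.
Defined.
End LeftCovariant.

Record category := Category {
  obj :> Type;
  hom : obj -> obj -> Type;
  idm : forall A, hom A A;
  comp : forall A B C, hom B C -> hom A B -> hom A C;
  compm1 : forall A B (f : hom A B), comp f (idm A) = f;
  comp1m : forall A B (f : hom A B), comp (idm B) f = f;
  compA : forall A B C D (h : hom C D) (g : hom B C) (f : hom A B),
    comp h (comp g f) = comp (comp h g) f }.

Arguments hom {c} A B.
Arguments idm {c} A.
Arguments comp {c A B C} g f.

Definition is_iso (C : category) (A B : C) (f : hom A B) : Prop :=
  exists2 g : hom B A, comp g f = idm A & comp f g = idm B.

(* Monoidal structures on C whose tensor product is tens on objects and whose
   unit object is unit. *)
Record monoidal (C : category) (tens : C -> C -> C) (unit : C) := Monoidal {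
  tensm : forall A A' B B' : C,
    hom A A' -> hom B B' -> hom (tens A B) (tens A' B');
  associator : forall A B D : C, hom (tens (tens A B) D) (tens A (tens B D));
  lunitor : forall A : C, hom (tens unit A) A;
  runitor : forall A : C, hom (tens A unit) A;
  tensm_id : forall A B : C, tensm (idm A) (idm B) = idm (tens A B);
  tensm_comp : forall (A A' A'' B B' B'' : C)
      (f' : hom A' A'') (f : hom A A') (g' : hom B' B'') (g : hom B B'),
    tensm (comp f' f) (comp g' g) = comp (tensm f' g') (tensm f g);
  associator_nat : forall (A A' B B' D D' : C)
      (f : hom A A') (g : hom B B') (h : hom D D'),
    comp (associator A' B' D') (tensm (tensm f g) h)
    = comp (tensm f (tensm g h)) (associator A B D);
  lunitor_nat : forall (A A' : C) (f : hom A A'),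
    comp (lunitor A') (tensm (idm unit) f) = comp f (lunitor A);
  runitor_nat : forall (A A' : C) (f : hom A A'),
    comp (runitor A') (tensm f (idm unit)) = comp f (runitor A);
  associator_iso : forall A B D : C, is_iso (associator A B D);
  lunitor_iso : forall A : C, is_iso (lunitor A);
  runitor_iso : forall A : C, is_iso (runitor A);
  pentagon : forall A B D E : C,
    comp (associator A B (tens D E)) (associator (tens A B) D E)
    = comp (tensm (idm A) (associator B D E))
        (comp (associator A (tens B D) E) (tensm (associator A B D) (idm E)));
  triangle : forall A B : C,
    comp (tensm (idm A) (lunitor B)) (associator A unit B)
    = tensm (runitor A) (idm B) }.

Arguments tensm {C tens unit} m {A A' B B'} f g.
Arguments associator {C tens unit} m A B D.
Arguments lunitor {C tens unit} m A.
Arguments runitor {C tens unit} m A.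

Section LcovCategory.
Variables (k : comPzRingType) (H : homHopf k).

Definition lcovCat : category.
Proof.
by refine (@Category (lcovBimod H) (@lcovHom k H) (@lcov_id k H)
  (@lcov_comp k H) _ _ _) => *; exact: lcovHom_eqP.
Defined.

Lemma lact2A (x y z : tensor H H) :
  lact2 (hmul H) (tmap (haut H) (haut H) x) (ract2 (hmul H) y z)
  = ract2 (hmul H) (lact2 (hmul H) x y) (tmap (haut H) (haut H) z).
Proof.
rewrite /lact2 /ract2.
elim/tensor_ind: x => [|a b x IHx].
  by rewrite !(linear0, pure0l).
rewrite !(linearD, pureDl) {}IHx; congr (_ + _).
elim/tensor_ind: y => [|c d y IHy].
  by rewrite !(linear0, pure0l, pure0r).
rewrite !(linearD, pureDl, pureDr) {}IHy; congr (_ + _).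
elim/tensor_ind: z => [|e f z IHz].
  by rewrite !(linear0, pure0l, pure0r).
rewrite !(linearD, pureDl, pureDr) {}IHz; congr (_ + _).
by rewrite !(tmidE, tmapE) !hmulA.
Qed.

Lemma tassocK (A B C : lmodType k) : cancel (tassoc A B C) (tassocV A B C).
Proof.
elim/tensor_ind => [|x c t IH]; first by rewrite !linear0.
rewrite !linearD IH; congr (_ + _).
elim/tensor_ind: x => [|a b x IHx]; first by rewrite !(linear0, pure0l).
by rewrite !(linearD, pureDl) IHx tassocE tassocVE.
Qed.

Fact regular_subproof :
  @is_left_covariant k H H (hmul H) (hmul H) (hcomul H).
Proof.
split.
- split.
  + by split=> *; rewrite ?haut_mul ?hmulA ?hmul1l.
  + by split=> *; rewrite ?haut_mul -?hmulA ?hmul1r.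
  + by move=> *; rewrite hmulA.
- split=> m; [exact: hcomul_aut | | exact: hcounitl].
  exact: etrans (esym (tassocK _)) (congr1 (tassocV H H H) (esym (hcomulA m))).
move=> h m g; rewrite hcomul_aut lact2A -hcomul_aut.
by rewrite /lact2 /ract2 -!hcomul_mul.
Qed.

Definition regular : lcovBimod H := LcovBimod (LcovStruct regular_subproof).

Section TensorOverH.
Variables M N : lcovBimod H.
Local Notation μ := (haut M).
Local Notation ν := (haut N).

Inductive tensH_rel : tensor M N -> Prop :=
| TensHRel m h n :
    tensH_rel (ract M (m ⊗ h) ⊗ n - μ m ⊗ lact N (h ⊗ hautV N n)).

Definition tensH_car : lmodType k := quotm tensH_rel.

Definition tensH_pi : {linear tensor M N -> tensH_car} := qpi tensH_rel.

Definition pureH (m : M) (n : N) : tensH_car := tensH_pi (m ⊗ n).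

Lemma pureH_rel m h n :
  pureH (ract M (m ⊗ h)) n = pureH (μ m) (lact N (h ⊗ hautV N n)).
Proof. exact/qpi_rel/TensHRel. Qed.

Lemma tensH_linearP (W : lmodType k) (f g : {linear tensH_car -> W}) :
  (forall m n, f (pureH m n) = g (pureH m n)) -> f =1 g.
Proof.
move=> fg; elim/qpiW => t.
by apply: (@tensor_linearP _ _ _ _ (f \o tensH_pi) (g \o tensH_pi)) t => m n;
  apply: fg.
Qed.

Lemma lact_aut (P : lcovBimod H) h m :
  haut P (lact P (h ⊗ m)) = lact P (haut H h ⊗ haut P m).
Proof. by case: (slcovP (lcov_str P)) => [[[E _ _] _ _] _ _]; apply: E. Qed.

Lemma ract_aut (P : lcovBimod H) m h :
  haut P (ract P (m ⊗ h)) = ract P (haut P m ⊗ haut H h).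
Proof. by case: (slcovP (lcov_str P)) => [[_ [E _ _] _] _ _]; apply: E. Qed.

Lemma lact_autV (P : lcovBimod H) h m :
  hautV P (lact P (h ⊗ m)) = lact P (hautV H h ⊗ hautV P m).
Proof. by apply: (can_inj (hautK (h := P))); rewrite hautVK lact_aut !hautVK. Qed.

Lemma ract_autV (P : lcovBimod H) m h :
  hautV P (ract P (m ⊗ h)) = ract P (hautV P m ⊗ hautV H h).
Proof. by apply: (can_inj (hautK (h := P))); rewrite hautVK ract_aut !hautVK. Qed.

Lemma tensH_aut_subproof t : tensH_rel t -> (tensH_pi \o tmap μ ν) t = 0.
Proof.
case=> m h n; apply/eqP; rewrite linearB subr_eq0 /= !tmapE; apply/eqP.
rewrite ract_aut lact_aut hautVK -[in RHS](hautK n); exact: pureH_rel.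
Qed.

Lemma tensH_autV_subproof t :
  tensH_rel t -> (tensH_pi \o tmap (hautV M) (hautV N)) t = 0.
Proof.
case=> m h n; apply/eqP; rewrite linearB subr_eq0 /= !tmapE; apply/eqP.
rewrite ract_autV lact_autV hautK -[in RHS](hautVK m); exact: pureH_rel.
Qed.

Definition tensH_aut : {linear tensH_car -> tensH_car} := qlift tensH_aut_subproof.
Definition tensH_autV : {linear tensH_car -> tensH_car} :=
  qlift tensH_autV_subproof.

Lemma tensH_autE m n : tensH_aut (pureH m n) = pureH (μ m) (ν n).
Proof. by rewrite /pureH /tensH_aut qliftE /= tmapE. Qed.

Lemma tensH_autVE m n :
  tensH_autV (pureH m n) = pureH (hautV M m) (hautV N n).
Proof. by rewrite /pureH /tensH_autV qliftE /= tmapE. Qed.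

Fact tensH_autK : cancel tensH_aut tensH_autV.
Proof.
apply: (@tensH_linearP _ (tensH_autV \o tensH_aut) idfun) => m n /=.
by rewrite tensH_autE tensH_autVE !hautK.
Qed.
Fact tensH_autVK : cancel tensH_autV tensH_aut.
Proof.
apply: (@tensH_linearP _ (tensH_aut \o tensH_autV) idfun) => m n /=.
by rewrite tensH_autVE tensH_autE !hautVK.
Qed.

Definition tensH : homMod k := HomMod tensH_autK tensH_autVK.
End TensorOverH.

End LcovCategory.

Arguments pureH {k H M N} m n.

(* Main.v *)
(* All structure maps are defined on generators and descend to M ⊗_H N because
   they are balanced; identities are checked on generators m ⊗_H n. The
   covariance condition, specialised to h = 1 and to g = 1, splits into the two
   multiplicativity rules ρ(mg) = m₍₋₁₎g₁ ⊗ m₍₀₎g₂ and ρ(hm) = h₁m₍₋₁₎ ⊗ h₂m₍₀₎,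
   which make the diagonal coaction balanced and the unit constraints colinear.
   The constraints are isomorphisms because each is bijective: the inverses are
   m ⊗ (n ⊗ p) |-> (μ⁻¹(m) ⊗ n) ⊗ π(p), m |-> 1 ⊗ μ⁻¹(m) and m |-> μ⁻¹(m) ⊗ 1. *)

Require Import Defs.
From HB Require Import structures.
From mathcomp Require Import all_boot all_algebra.
Local Open Scope ring_scope.

Set Implicit Arguments.
Unset Strict Implicit.
Unset Printing Implicit Defensive.

Import GRing.Theory.

Section LeftCovariantTensor.
Variables (k : comPzRingType) (H : homHopf k).
Implicit Types M N P : lcovBimod H.

(** * Axioms of a left-covariant Hom-bimodule and their direct consequences *)

Section StructureMaps.
Variable P : lcovBimod H.
Lemma lactA g h (m : P) :
  lact P (haut H g ⊗ lact P (h ⊗ m)) = lact P (hmul H (g ⊗ h) ⊗ haut P m).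
Proof. by case: (slcovP (lcov_str P)) => -[[_ E _] _ _] _ _; apply: E. Qed.

Lemma lact1 (m : P) : lact P (hone H ⊗ m) = haut P m.
Proof. by case: (slcovP (lcov_str P)) => -[[_ _ E] _ _] _ _; apply: E. Qed.

Lemma ractA (m : P) g h :
  ract P (ract P (m ⊗ g) ⊗ haut H h) = ract P (haut P m ⊗ hmul H (g ⊗ h)).
Proof. by case: (slcovP (lcov_str P)) => -[_ [_ E _] _] _ _; apply: E. Qed.

Lemma ract1 (m : P) : ract P (m ⊗ hone H) = haut P m.
Proof. by case: (slcovP (lcov_str P)) => -[_ [_ _ E] _] _ _; apply: E. Qed.

Lemma lractA g (m : P) h :
  ract P (lact P (g ⊗ m) ⊗ haut H h) = lact P (haut H g ⊗ ract P (m ⊗ h)).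
Proof. by case: (slcovP (lcov_str P)) => -[_ _ E] _ _; apply: E. Qed.

Lemma coact_aut (m : P) :
  coact P (haut P m) = tmap (haut H) (haut P) (coact P m).
Proof. by case: (slcovP (lcov_str P)) => _ [E _ _] _; apply: E. Qed.

Lemma coactA (m : P) : tmap (hcomul H) (hautV P) (coact P m)
  = tassocV _ _ _ (tmap (hautV H) (coact P) (coact P m)).
Proof. by case: (slcovP (lcov_str P)) => _ [_ E _] _; apply: E. Qed.

Lemma coact_counit (m : P) : contrl P (hcounit H) (coact P m) = hautV P m.
Proof. by case: (slcovP (lcov_str P)) => _ [_ _ E] _; apply: E. Qed.

Lemma coact_covariant h (m : P) g :
  coact P (ract P (lact P (h ⊗ m) ⊗ haut H g))
  = lact2 (lact P) (hcomul H (haut H h)) (ract2 (ract P) (coact P m) (hcomul H g)).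
Proof. by case: (slcovP (lcov_str P)) => _ _ E; apply: E. Qed.

(** The inverse is [α⁻¹ ⊗ μ⁻¹]. Acting by a unit in the Hom setting applies the automorphism instead
    of the identity, so identities in [H ⊗ P] derived from the unit laws come out shifted by
    [α ⊗ μ]; this lemma removes the shift. *)
Lemma tmap_aut_inj : injective (tmap (haut H) (haut P)).
Proof.
apply: (can_inj (g := tmap (hautV H) (hautV P))) => t.
rewrite tmap_comp -[RHS]tmap_id; move: t.
by apply: tensor_linearP => h m; rewrite !tmapE /= !hautK.
Qed.
End StructureMaps.

Lemma hautV_mul a b :
  hautV H (hmul H (a ⊗ b)) = hmul H (hautV H a ⊗ hautV H b).
Proof. by apply: (can_inj (hautK (h := H))); rewrite hautVK haut_mul !hautVK. Qed.

Lemma hautV_one : hautV H (hone H) = hone H.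
Proof. by rewrite -[in LHS]haut_one hautK. Qed.

Section PureHLinear.
Variables M N : lcovBimod H.
Lemma pureHDl (m m' : M) (n : N) : pureH (m + m') n = pureH m n + pureH m' n.
Proof. by rewrite /pureH pureDl linearD. Qed.
Lemma pureHDr (m : M) (n n' : N) : pureH m (n + n') = pureH m n + pureH m n'.
Proof. by rewrite /pureH pureDr linearD. Qed.
Lemma pureH0l (n : N) : pureH (0 : M) n = 0.
Proof. by rewrite /pureH pure0l linear0. Qed.
Lemma pureH0r (m : M) : pureH m (0 : N) = 0.
Proof. by rewrite /pureH pure0r linear0. Qed.
Lemma pureHZ a b (m : M) (n : N) : pureH (a *: m) (b *: n) = (a * b) *: pureH m n.
Proof. by rewrite /pureH pureZl pureZr scalerA linearZ. Qed.
End PureHLinear.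

(** Reduces a goal additive in [t] to pure tensors: the zero case vanishes on both sides, and in the
    inductive case the remainder cancels by hypothesis. The two factors are put back in the goal so
    that the caller names them. *)
Ltac tensor_elim t :=
  let a := fresh "a" in let b := fresh "b" in
  let u := fresh "u" in let IH := fresh "IH" in
  elim/tensor_ind: t => [|a b u IH];
  [by rewrite !(linear0, pure0l, pure0r, pureH0l, pureH0r)
  | rewrite !(linearD, pureDl, pureDr, pureHDl, pureHDr) {}IH; congr (_ + _); move: a b {u}].

(** After the shift by [α ⊗ μ], the left side is the coaction of [μ(m)α(g) = (1m)α(g)], which has
    the shape governed by covariance. The factor [Δ(1) = 1 ⊗ 1] then acts as [α ⊗ μ], matching the
    shift on the right. *)
Lemma coact_ract P (m : P) g :
  coact P (ract P (m ⊗ g)) = ract2 (ract P) (coact P m) (hcomul H g).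
Proof.
apply: tmap_aut_inj; rewrite -coact_aut ract_aut -lact1 coact_covariant.
rewrite haut_one hcomul_one.
move: (ract2 _ _ _) => t; rewrite /lact2; tensor_elim t => a b.
by rewrite tmidE !tmapE hmul1l lact1.
Qed.

(** Same device with the unit on the other side: [μ(hm) = (hm)1 = (hm)α(1)], and the right action of
    [1 ⊗ 1] supplies the shift. *)
Lemma coact_lact P h (m : P) :
  coact P (lact P (h ⊗ m)) = lact2 (lact P) (hcomul H h) (coact P m).
Proof.
apply: tmap_aut_inj; rewrite -coact_aut -ract1 -(haut_one H) coact_covariant.
rewrite hcomul_one hcomul_aut /lact2 /ract2.
move: (hcomul H h) (coact P m) => x t; tensor_elim x => a b; tensor_elim t => c d.
by rewrite !(tmidE, tmapE) haut_mul lact_aut hmul1r ract1.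
Qed.

Lemma tensH_ind M N (Q : tensH_car M N -> Prop) :
  Q 0 -> (forall m n q, Q q -> Q (pureH m n + q)) -> forall q, Q q.
Proof.
move=> Q0 QD; elim/qpiW; rewrite -/(tensH_pi M N).
elim/tensor_ind => [|m n t IH]; first by rewrite linear0.
by rewrite linearD; apply: QD.
Qed.

Lemma coact_autV P (m : P) :
  coact P (hautV P m) = tmap (hautV H) (hautV P) (coact P m).
Proof.
apply: tmap_aut_inj; rewrite -coact_aut hautVK tmap_comp -[LHS]tmap_id.
by move: (coact P m); apply: tensor_linearP => h n; rewrite !tmapE /= !hautVK.
Qed.

(** * Universal property of the tensor product over H *)

Section Lift.
Variables (M N : lcovBimod H) (A W : lmodType k).

(** The Hom version of an H-balanced map: the condition for [f] to coequalize the two arrows that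
    define [M ⊗_H N]. *)
Definition balanced (f : M -> N -> W) :=
  forall m h n, f (ract M (m ⊗ h)) n = f (haut M m) (lact N (h ⊗ hautV N n)).

Section Lift1.
Variable f : {linear tensor M N -> W}.
Hypothesis fb : balanced (fun m n => f (m ⊗ n)).

Fact tensH_lift_subproof t : tensH_rel t -> f t = 0.
Proof. by case=> m h n; apply/eqP; rewrite linearB subr_eq0 fb. Qed.

Definition tensH_lift : {linear tensH_car M N -> W} := qlift tensH_lift_subproof.

Lemma tensH_liftE m n : tensH_lift (pureH m n) = f (m ⊗ n).
Proof. exact: qliftE. Qed.
End Lift1.

Section LiftR.
Variable f : {linear tensor A (tensor M N) -> W}.
Hypothesis fb : forall a, balanced (fun m n => f (a ⊗ (m ⊗ n))).

(** For each fixed [a] the map descends to [M ⊗_H N]. The descended maps depend linearly on [a], so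
    together they form a bilinear map, which [tlift] turns into a linear one on [A ⊗ (M ⊗_H N)]. *)
Definition tensH_liftr_at a : {linear tensH_car M N -> W} :=
  tensH_lift (f := f \o mklin (@pure_linearr k A (tensor M N) a)) (fb a).

Lemma tensH_liftr_atE a m n : tensH_liftr_at a (pureH m n) = f (a ⊗ (m ⊗ n)).
Proof. exact: tensH_liftE. Qed.

Fact tensH_liftr_linear q : linear (fun a => tensH_liftr_at a q).
Proof.
move=> c a a'; elim/tensH_ind: q => [|m n q IH].
  by rewrite !linear0 addr0.
by rewrite !linearD IH !tensH_liftr_atE pure_linearl linearP addrACA.
Qed.

Definition tensH_liftr : {linear tensor A (tensH_car M N) -> W} :=
  tlift _ tensH_liftr_linear (fun a => linearP (tensH_liftr_at a)).

Lemma tensH_liftrE a m n : tensH_liftr (a ⊗ pureH m n) = f (a ⊗ (m ⊗ n)).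
Proof. by rewrite tliftE tensH_liftr_atE. Qed.
End LiftR.

Section LiftL.
Variable f : {linear tensor (tensor M N) A -> W}.
Hypothesis fb : forall a, balanced (fun m n => f (m ⊗ n ⊗ a)).

(** Swapping the factors reduces a quotient in the left factor to one in the right factor. *)
Fact tensH_liftl_subproof a :
  balanced (fun m n => (f \o tswap A (tensor M N)) (a ⊗ (m ⊗ n))).
Proof. by move=> m h n; rewrite /= !tswapE; apply: fb. Qed.

Definition tensH_liftl : {linear tensor (tensH_car M N) A -> W} :=
  tensH_liftr tensH_liftl_subproof \o tswap (tensH_car M N) A.

Lemma tensH_liftlE m n a : tensH_liftl (pureH m n ⊗ a) = f (m ⊗ n ⊗ a).
Proof. by rewrite /tensH_liftl /= tswapE tensH_liftrE /= tswapE. Qed.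
End LiftL.
End Lift.

Ltac tensH_elim t :=
  let m := fresh "m" in let n := fresh "n" in
  let u := fresh "u" in let IH := fresh "IH" in
  elim/tensH_ind: t => [|m n u IH];
  [by rewrite !(linear0, pure0l, pure0r, pureH0l, pureH0r)
  | rewrite !(linearD, pureDl, pureDr, pureHDl, pureHDr) {}IH; congr (_ + _); move: m n {u}].

(** * The left-covariant Hom-bimodule structure on the tensor product over H *)

Section TensorObject.
Variables M N : lcovBimod H.
Local Notation μ := (haut M).
Local Notation ν := (haut N).
Local Notation T := (tensH M N).

Definition tensH_lact_fun : {linear tensor H (tensor M N) -> T} :=
  tensH_pi M N \o tmap (lact M \o tmap (hautV H) idfun) ν \o tassocV H M N.

Fact tensH_lact_balanced h :
  balanced (fun m n => tensH_lact_fun (h ⊗ (m ⊗ n))).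
Proof.
move=> m g n; rewrite /= !tassocVE !tmapE /= !tmapE -!/(pureH _ _) /=.
(* Writing [α⁻¹(h)] as [α(α⁻²(h))] makes the bimodule law applicable: it moves [g] to the outside of
   the left factor, where the relation carries it over to [N]. *)
by rewrite -[hautV H h]hautVK -lractA pureH_rel hautK !lact_aut !hautVK.
Qed.

Definition tensH_lact : {linear tensor H T -> T} := tensH_liftr tensH_lact_balanced.

Lemma tensH_lactE h m n :
  tensH_lact (h ⊗ pureH m n) = pureH (lact M (hautV H h ⊗ m)) (ν n).
Proof. by rewrite tensH_liftrE /= tassocVE tmapE /= tmapE. Qed.

Definition tensH_ract_fun : {linear tensor (tensor M N) H -> T} :=
  tensH_pi M N \o tmap μ (ract N \o tmap idfun (hautV H)) \o tassoc M N H.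

Fact tensH_ract_balanced h :
  balanced (fun m n => tensH_ract_fun (m ⊗ n ⊗ h)).
Proof.
move=> m g n; rewrite /= !tassocE !tmapE /= !tmapE -!/(pureH _ _) /=.
by rewrite ract_aut pureH_rel ract_autV -lractA (hautVK (h := H)).
Qed.

Definition tensH_ract : {linear tensor T H -> T} := tensH_liftl tensH_ract_balanced.

Lemma tensH_ractE m n h :
  tensH_ract (pureH m n ⊗ h) = pureH (μ m) (ract N (n ⊗ hautV H h)).
Proof. by rewrite tensH_liftlE /= tassocE tmapE /= tmapE. Qed.

Definition tensH_coact_fun : {linear tensor M N -> tensor H T} :=
  tmap (hmul H) (tensH_pi M N) \o tmid _ _ _ _ \o tmap (coact M) (coact N).

Fact tensH_coact_balanced :
  balanced (fun m n => tensH_coact_fun (m ⊗ n)).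
Proof.
move=> m g n; rewrite /= !tmapE coact_ract coact_lact coact_aut coact_autV.
rewrite /lact2 /ract2; move: (coact M m) (hcomul H g) (coact N n) => x y z.
tensor_elim x => a b; tensor_elim y => c d; tensor_elim z => e f.
(* The relation over H identifies the second legs; the first legs [(ac)e] and [α(a)(c α⁻¹(e))] agree
   by Hom-associativity. *)
rewrite !(tmidE, tmapE) -!/(pureH _ _) pureH_rel.
by rewrite hmulA (hautVK (h := H)).
Qed.

Definition tensH_coact : {linear T -> tensor H T} := tensH_lift tensH_coact_balanced.

Lemma tensH_coactE m n : tensH_coact (pureH m n)
  = tmap (hmul H) (tensH_pi M N) (tmid _ _ _ _ (coact M m ⊗ coact N n)).
Proof. by rewrite tensH_liftE /= tmapE. Qed.
End TensorObject.

Fact tensH_left_covariant M N :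
  is_left_covariant (tensH_lact M N) (tensH_ract M N) (tensH_coact M N).
Proof.
split.
- split; first split.
  + move=> h q; tensH_elim q => m n.
    by rewrite !(tensH_autE, tensH_lactE) lact_aut hautK hautVK.
  + move=> g h q; tensH_elim q => m n.
    by rewrite !(tensH_autE, tensH_lactE) hautV_mul -lactA hautK hautVK.
  + move=> q; tensH_elim q => m n.
    by rewrite tensH_autE tensH_lactE hautV_one lact1.
  + split.
    * move=> q h; tensH_elim q => m n.
      by rewrite !(tensH_autE, tensH_ractE) ract_aut hautK hautVK.
    * move=> q g h; tensH_elim q => m n.
      by rewrite !(tensH_autE, tensH_ractE) hautV_mul -ractA hautK hautVK.
    * move=> q; tensH_elim q => m n.
      by rewrite tensH_autE tensH_ractE hautV_one ract1.
  + move=> g q h; tensH_elim q => m n.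
    by rewrite !(tensH_lactE, tensH_ractE) lact_aut ract_aut !hautK !hautVK.
- split.
  + move=> q; tensH_elim q => m n.
    rewrite tensH_autE !tensH_coactE !coact_aut.
    move: (coact M _) (coact N _) => x y; tensor_elim x => a b; tensor_elim y => c d.
    by rewrite !(tmapE, tmidE) -!/(pureH _ _) tensH_autE haut_mul.
  + move=> q; tensH_elim q => m n.
    (* The Sweedler map with which both sides of coassociativity of M ⊗_H N are
       obtained from the corresponding sides for M and N. *)
    pose F x y := tmap (tmap (hmul H) (hmul H) \o tmid _ _ _ _) (tensH_pi M N)
      (tmid _ _ _ _ (x ⊗ y)).
    transitivity (F (tmap (hcomul H) (hautV M) (coact M m))
                    (tmap (hcomul H) (hautV N) (coact N n))).
      rewrite tensH_coactE /F; move: (coact M _) (coact N _) => x y.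
      tensor_elim x => a b; tensor_elim y => c d.
      by rewrite !(tmapE, tmidE) /= -!/(pureH _ _) tensH_autVE hcomul_mul.
    rewrite !coactA tensH_coactE /F; move: (coact M _) (coact N _) => x y.
    tensor_elim x => a b; tensor_elim y => c d.
    rewrite !(tmapE, tmidE) -!/(pureH _ _) tensH_coactE hautV_mul.
    move: (coact M _) (coact N _) => x y; tensor_elim x => e f; tensor_elim y => i j.
    by rewrite !(tmapE, tmidE, tassocVE) /= !(tmidE, tmapE).
  + move=> q; tensH_elim q => m n.
    (* The counit laws of [M] and [N] express [μ⁻¹(m)] and [ν⁻¹(n)] through the coactions, so that
       only multiplicativity of [ε] remains. *)
    rewrite tensH_autVE tensH_coactE -!coact_counit.
    move: (coact M _) (coact N _) => x y; tensor_elim x => a b; tensor_elim y => c d.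
    by rewrite !(tmidE, tmapE, contrlE) hcounit_mul pureHZ.
(* Replacing [h] by [α(h)], possible since [α] is onto, cancels the [α⁻¹] in the left action on
   [M ⊗_H N]. *)
move=> h q g; rewrite -[h]hautVK /lact2 /ract2; move: (hautV H h) => {}h.
tensH_elim q => m n.
rewrite tensH_lactE tensH_ractE !tensH_coactE !hautK !coact_aut coact_lact.
rewrite coact_ract coact_aut !hcomul_aut /lact2 /ract2.
move: (coact M _) (coact N _) (hcomul H h) (hcomul H g) => x y z t.
tensor_elim x => a b; tensor_elim y => c d.
tensor_elim z => e f; tensor_elim t => i j.
rewrite !(tmapE, tmidE) -!/(pureH _ _) tensH_ractE tensH_lactE.
rewrite hautK lact_aut ract_aut hautVK; congr (_ ⊗ _).
(* The first legs are [α(ea)(α(c)i)] and [α²(e)((ac)i)]. With [i = α(α⁻¹(i))], two uses of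
   Hom-associativity turn the second into the first. *)
by rewrite -[i in RHS]hautVK -[in RHS]hmulA [RHS]hmulA !haut_mul hautVK.
Qed.

Definition lcov_tensH M N : lcov_struct H (tensH M N) :=
  LcovStruct (tensH_left_covariant M N).

Definition lcov_tens M N : lcovBimod H := LcovBimod (lcov_tensH M N).

(** * Criteria for morphisms and isomorphisms *)

Lemma lcov_iso (M N : lcovCat H) (f : lcovHom M N) (g : {linear N -> M}) :
  cancel f g -> cancel g f -> @is_iso (lcovCat H) M N f.
Proof.
(* Injectivity of [f] reduces the linearity conditions on [g] to those on [f]. Colinearity follows
   by writing [n] as [f (g n)] and cancelling [g \o f] in the second leg. *)
move=> fK gK; have fI := can_inj fK.
have g_aut n : haut M (g n) = g (haut N n).
  by apply: fI; rewrite -lcov_aut !gK.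
have g_lact h n : g (lact N (h ⊗ n)) = lact M (h ⊗ g n).
  by apply: fI; rewrite lcov_lact !gK.
have g_ract n h : g (ract N (n ⊗ h)) = ract M (g n ⊗ h).
  by apply: fI; rewrite lcov_ract !gK.
have g_coact n : coact M (g n) = tmap idfun g (coact N n).
  rewrite -{2}[n]gK lcov_coact tmap_comp -[LHS]tmap_id.
  by move: (coact M _); apply: tensor_linearP => h m; rewrite !tmapE /= fK.
by exists (LcovHom g_aut g_lact g_ract g_coact); apply: lcovHom_eqP.
Qed.

Lemma coact_tens M N m n : coact (lcov_tens M N) (pureH m n)
  = tmap (hmul H) (tensH_pi M N) (tmid _ _ _ _ (coact M m ⊗ coact N n)).
Proof. exact: tensH_coactE. Qed.

Section OnTensH.
Variables (M N P : lcovBimod H) (f : {linear tensH M N -> P}).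
Hypothesis f_aut : forall m n,
  haut P (f (pureH m n)) = f (pureH (haut M m) (haut N n)).
Hypothesis f_lact : forall h m n,
  f (pureH (lact M (hautV H h ⊗ m)) (haut N n)) = lact P (h ⊗ f (pureH m n)).
Hypothesis f_ract : forall m n h,
  f (pureH (haut M m) (ract N (n ⊗ hautV H h))) = ract P (f (pureH m n) ⊗ h).
Hypothesis f_coact : forall m n, coact P (f (pureH m n))
  = tmap (hmul H) (f \o tensH_pi M N) (tmid _ _ _ _ (coact M m ⊗ coact N n)).

Fact tensH_hom_aut q : haut P (f q) = f (haut (lcov_tens M N) q).
Proof. by tensH_elim q => m n; rewrite f_aut -tensH_autE. Qed.

Fact tensH_hom_lact h q : f (lact (lcov_tens M N) (h ⊗ q)) = lact P (h ⊗ f q).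
Proof. by tensH_elim q => m n; rewrite -f_lact -tensH_lactE. Qed.

Fact tensH_hom_ract q h : f (ract (lcov_tens M N) (q ⊗ h)) = ract P (f q ⊗ h).
Proof. by tensH_elim q => m n; rewrite -f_ract -tensH_ractE. Qed.

Fact tensH_hom_coact q :
  coact P (f q) = tmap idfun f (coact (lcov_tens M N) q).
Proof.
tensH_elim q => m n; rewrite f_coact /= tensH_coactE tmap_comp.
move: (tmid _ _ _ _ _); apply: tensor_linearP => a b.
by rewrite !tmapE.
Qed.

(** Used to build the tensor product of morphisms and all three constraints: every condition on a
    morphism is additive, hence determined on generators, where the structure maps of [M ⊗_H N] are
    explicit. *)
Definition tensH_hom : lcovHom (lcov_tens M N) P :=
  @LcovHom k H (lcov_tens M N) P f
    tensH_hom_aut tensH_hom_lact tensH_hom_ract tensH_hom_coact.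
End OnTensH.

Lemma tensH_hom_ext M N P (f g : lcovHom (lcov_tens M N) P) :
  (forall m n, f (pureH m n) = g (pureH m n)) -> f = g.
Proof. by move=> fg; apply/lcovHom_eqP/tensH_linearP. Qed.

Lemma lcov_autV M N (f : lcovHom M N) m : hautV N (f m) = f (hautV M m).
Proof.
by apply: (can_inj (hautK (h := N))); rewrite hautVK lcov_aut hautVK.
Qed.

(** * Functoriality of the tensor product over H *)

Section Functor.
Variables (M M' N N' : lcovBimod H) (f : lcovHom M M') (g : lcovHom N N').

Definition tensH_map_fun : {linear tensor M N -> tensH_car M' N'} :=
  tensH_pi M' N' \o tmap f g.

Fact tensH_map_balanced : balanced (fun m n => tensH_map_fun (m ⊗ n)).
Proof.
move=> m h n; rewrite /= !tmapE -!/(pureH _ _) lcov_ract pureH_rel.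
by rewrite lcov_lact lcov_aut lcov_autV.
Qed.

Definition tensH_map_lin : {linear tensH M N -> lcov_tens M' N'} :=
  tensH_lift tensH_map_balanced.

Lemma tensH_map_linE m n : tensH_map_lin (pureH m n) = pureH (f m) (g n).
Proof. by rewrite /tensH_map_lin tensH_liftE /= tmapE. Qed.

Fact tensH_map_aut m n : haut (lcov_tens M' N') (tensH_map_lin (pureH m n))
  = tensH_map_lin (pureH (haut M m) (haut N n)).
Proof. by rewrite !tensH_map_linE [LHS]tensH_autE !lcov_aut. Qed.

Fact tensH_map_lact h m n :
  tensH_map_lin (pureH (lact M (hautV H h ⊗ m)) (haut N n))
  = lact (lcov_tens M' N') (h ⊗ tensH_map_lin (pureH m n)).
Proof. by rewrite !tensH_map_linE [RHS]tensH_lactE lcov_lact lcov_aut. Qed.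

Fact tensH_map_ract m n h :
  tensH_map_lin (pureH (haut M m) (ract N (n ⊗ hautV H h)))
  = ract (lcov_tens M' N') (tensH_map_lin (pureH m n) ⊗ h).
Proof. by rewrite !tensH_map_linE [RHS]tensH_ractE lcov_ract lcov_aut. Qed.

Fact tensH_map_coact m n :
  coact (lcov_tens M' N') (tensH_map_lin (pureH m n))
  = tmap (hmul H) (tensH_map_lin \o tensH_pi M N)
      (tmid _ _ _ _ (coact M m ⊗ coact N n)).
Proof.
rewrite tensH_map_linE coact_tens !lcov_coact.
move: (coact M m) (coact N n) => x y.
tensor_elim x => a b; tensor_elim y => c d.
by rewrite !(tmapE, tmidE) /= -!/(pureH _ _) tensH_map_linE.
Qed.

Definition tensH_map : lcovHom (lcov_tens M N) (lcov_tens M' N') :=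
  tensH_hom tensH_map_aut tensH_map_lact tensH_map_ract tensH_map_coact.

Lemma tensH_mapE m n : tensH_map (pureH m n) = pureH (f m) (g n).
Proof. exact: tensH_map_linE. Qed.
End Functor.

(** * The associativity constraint and its inverse *)

Section Associator.
Variables M N P : lcovBimod H.
Local Notation MN := (lcov_tens M N).
Local Notation NP := (lcov_tens N P).

Definition tensH_assoc_fun : {linear tensor (tensor M N) P -> tensH M NP} :=
  tensH_pi M NP \o tmap (haut M) (tensH_pi N P \o tmap idfun (hautV P))
    \o tassoc M N P.

Lemma tensH_assoc_funE m n p : tensH_assoc_fun (m ⊗ n ⊗ p)
  = @pureH k H M NP (haut M m) (pureH n (hautV P p)).
Proof. by rewrite /= tassocE tmapE /= tmapE. Qed.

(** The scalar [α(h)] coming from [μ(mh)] crosses the outer tensor sign and acts on [N ⊗_H P], whose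
    left action applies [α⁻¹] and so lets [h] itself act on [N]. *)
Fact tensH_assoc_fun_balanced p :
  balanced (fun m n => tensH_assoc_fun (m ⊗ n ⊗ p)).
Proof.
move=> m h n; rewrite !tensH_assoc_funE ract_aut pureH_rel.
rewrite [hautV NP _]tensH_autVE [lact NP _]tensH_lactE hautK.
by rewrite hautVK.
Qed.

Definition tensH_assoc_fun2 : {linear tensor MN P -> tensH M NP} :=
  tensH_liftl tensH_assoc_fun_balanced.

Lemma tensH_assoc_fun2E m n p : tensH_assoc_fun2 (pureH m n ⊗ p)
  = @pureH k H M NP (haut M m) (pureH n (hautV P p)).
Proof. by rewrite [LHS]tensH_liftlE tensH_assoc_funE. Qed.

(** Here the scalar acts on the [N] factor of [M ⊗_H N], so the relation is applied inside
    [N ⊗_H P]. *)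
Fact tensH_assoc_balanced : balanced (fun q p => tensH_assoc_fun2 (q ⊗ p)).
Proof.
move=> q h p; tensH_elim q => m n.
rewrite [haut MN _]tensH_autE [ract MN _]tensH_ractE !tensH_assoc_fun2E.
by rewrite pureH_rel !lact_autV.
Qed.

Definition tensH_assoc_lin : {linear tensH MN P -> lcov_tens M NP} :=
  tensH_lift tensH_assoc_balanced.

Lemma tensH_assoc_linE m n p : tensH_assoc_lin (@pureH k H MN P (pureH m n) p)
  = @pureH k H M NP (haut M m) (pureH n (hautV P p)).
Proof. by rewrite [LHS]tensH_liftE tensH_assoc_fun2E. Qed.

Fact tensH_assoc_aut q p :
  haut (lcov_tens M NP) (tensH_assoc_lin (@pureH k H MN P q p))
  = tensH_assoc_lin (@pureH k H MN P (haut MN q) (haut P p)).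
Proof.
tensH_elim q => m n; rewrite [haut MN _]tensH_autE !tensH_assoc_linE.
by rewrite [LHS]tensH_autE [haut NP _]tensH_autE hautK hautVK.
Qed.

Fact tensH_assoc_lact h q p :
  tensH_assoc_lin (@pureH k H MN P (lact MN (hautV H h ⊗ q)) (haut P p))
  = lact (lcov_tens M NP) (h ⊗ tensH_assoc_lin (@pureH k H MN P q p)).
Proof.
tensH_elim q => m n; rewrite [lact MN _]tensH_lactE !tensH_assoc_linE.
rewrite [RHS]tensH_lactE [haut NP _]tensH_autE lact_aut.
by rewrite hautK !hautVK.
Qed.

Fact tensH_assoc_ract q p h :
  tensH_assoc_lin (@pureH k H MN P (haut MN q) (ract P (p ⊗ hautV H h)))
  = ract (lcov_tens M NP) (tensH_assoc_lin (@pureH k H MN P q p) ⊗ h).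
Proof.
tensH_elim q => m n; rewrite [haut MN _]tensH_autE !tensH_assoc_linE.
by rewrite [RHS]tensH_ractE [ract NP _]tensH_ractE ract_autV.
Qed.

Fact tensH_assoc_coact q p :
  coact (lcov_tens M NP) (tensH_assoc_lin (@pureH k H MN P q p))
  = tmap (hmul H) (tensH_assoc_lin \o tensH_pi MN P)
      (tmid _ _ _ _ (coact MN q ⊗ coact P p)).
Proof.
tensH_elim q => m n; rewrite tensH_assoc_linE !coact_tens coact_aut coact_autV.
move: (coact M m) (coact N n) (coact P p) => x y z.
tensor_elim x => a b; tensor_elim y => c d; tensor_elim z => e f.
rewrite !(tmapE, tmidE) /= -!/(pureH _ _) tensH_assoc_linE.
by rewrite hmulA hautVK.
Qed.

Definition tensH_assoc : lcovHom (lcov_tens MN P) (lcov_tens M NP) :=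
  tensH_hom tensH_assoc_aut tensH_assoc_lact tensH_assoc_ract tensH_assoc_coact.

Lemma tensH_assocE m n p : tensH_assoc (@pureH k H MN P (pureH m n) p)
  = @pureH k H M NP (haut M m) (pureH n (hautV P p)).
Proof. exact: tensH_assoc_linE. Qed.

Definition tensH_assocV_fun : {linear tensor M (tensor N P) -> tensH MN P} :=
  tensH_pi MN P \o tmap (tensH_pi M N \o tmap (hautV M) idfun) (haut P)
    \o tassocV M N P.

Lemma tensH_assocV_funE m n p : tensH_assocV_fun (m ⊗ (n ⊗ p))
  = @pureH k H MN P (pureH (hautV M m) n) (haut P p).
Proof. by rewrite /= tassocVE tmapE /= tmapE. Qed.

Fact tensH_assocV_fun_balanced m :
  balanced (fun n p => tensH_assocV_fun (m ⊗ (n ⊗ p))).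
Proof.
move=> n h p; rewrite !tensH_assocV_funE lact_aut hautVK.
(* To let [h] cross to [P], it must appear as a right action on [M ⊗_H N]. That action applies [μ]
   to the first factor and [α⁻¹] to the scalar, whence [μ⁻²(m)] and [α(h)]. *)
have -> : pureH (hautV M m) (ract N (n ⊗ h))
          = ract MN (pureH (hautV M (hautV M m)) n ⊗ haut H h).
  by rewrite [RHS]tensH_ractE hautK hautVK.
by rewrite pureH_rel [haut MN _]tensH_autE hautK hautVK.
Qed.

Definition tensH_assocV_fun2 : {linear tensor M NP -> tensH MN P} :=
  tensH_liftr tensH_assocV_fun_balanced.

Lemma tensH_assocV_fun2E m n p : tensH_assocV_fun2 (m ⊗ pureH n p)
  = @pureH k H MN P (pureH (hautV M m) n) (haut P p).
Proof. by rewrite [LHS]tensH_liftrE tensH_assocV_funE. Qed.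

Fact tensH_assocV_balanced : balanced (fun m q => tensH_assocV_fun2 (m ⊗ q)).
Proof.
move=> m h q; tensH_elim q => n p.
rewrite [hautV NP _]tensH_autVE [lact NP _]tensH_lactE !tensH_assocV_fun2E.
by rewrite ract_autV pureH_rel !hautK !hautVK.
Qed.

Definition tensH_assocV : {linear lcov_tens M NP -> lcov_tens MN P} :=
  tensH_lift tensH_assocV_balanced.

Lemma tensH_assocVE m n p : tensH_assocV (@pureH k H M NP m (pureH n p))
  = @pureH k H MN P (pureH (hautV M m) n) (haut P p).
Proof. by rewrite [LHS]tensH_liftE tensH_assocV_fun2E. Qed.

Lemma tensH_assocK : cancel tensH_assoc tensH_assocV.
Proof.
move=> t; tensH_elim t => q p; tensH_elim q => m n.
by rewrite tensH_assocE tensH_assocVE hautK hautVK.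
Qed.

Lemma tensH_assocVK : cancel tensH_assocV tensH_assoc.
Proof.
move=> t; tensH_elim t => m q; tensH_elim q => n p.
by rewrite tensH_assocVE tensH_assocE hautK hautVK.
Qed.
End Associator.

(** * The left and right unit constraints *)

Section Units.
Variable M : lcovBimod H.
Local Notation R := (regular H).

(** This is Hom-associativity of the left action, with [m] written as [μ(μ⁻¹(m))]. *)
Fact tensH_unitl_balanced : balanced (M := R) (N := M) (fun h m => lact M (h ⊗ m)).
Proof.
by move=> h g m; rewrite -[m in LHS](hautVK (h := M)); symmetry; apply: lactA.
Qed.

Definition tensH_unitl_lin : {linear tensH R M -> M} :=
  tensH_lift tensH_unitl_balanced.

Lemma tensH_unitl_linE (h : R) m : tensH_unitl_lin (pureH h m) = lact M (h ⊗ m).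
Proof. exact: tensH_liftE. Qed.

Fact tensH_unitl_aut (h : R) m : haut M (tensH_unitl_lin (pureH h m))
  = tensH_unitl_lin (pureH (haut R h) (haut M m)).
Proof. by rewrite !tensH_unitl_linE lact_aut. Qed.

Fact tensH_unitl_lact h (g : R) m :
  tensH_unitl_lin (pureH (lact R (hautV H h ⊗ g)) (haut M m))
  = lact M (h ⊗ tensH_unitl_lin (pureH g m)).
Proof. by rewrite !tensH_unitl_linE -[lact R _]/(hmul H _) -lactA hautVK. Qed.

Fact tensH_unitl_ract (g : R) m h :
  tensH_unitl_lin (pureH (haut R g) (ract M (m ⊗ hautV H h)))
  = ract M (tensH_unitl_lin (pureH g m) ⊗ h).
Proof. by rewrite !tensH_unitl_linE -lractA hautVK. Qed.

Fact tensH_unitl_coact (h : R) m : coact M (tensH_unitl_lin (pureH h m))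
  = tmap (hmul H) (tensH_unitl_lin \o tensH_pi R M)
      (tmid _ _ _ _ (coact R h ⊗ coact M m)).
Proof.
rewrite tensH_unitl_linE coact_lact /lact2 -[coact R h]/(hcomul H h).
move: (hcomul H h) (coact M m) => x y.
tensor_elim x => a b; tensor_elim y => c d.
by rewrite !(tmapE, tmidE) /= -!/(pureH _ _) tensH_unitl_linE.
Qed.

Definition tensH_unitl : lcovHom (lcov_tens R M) M :=
  tensH_hom tensH_unitl_aut tensH_unitl_lact tensH_unitl_ract tensH_unitl_coact.

Lemma tensH_unitlE (h : R) m : tensH_unitl (pureH h m) = lact M (h ⊗ m).
Proof. exact: tensH_unitl_linE. Qed.

Definition tensH_unitlV : {linear M -> lcov_tens R M} :=
  tensH_pi R M \o mklin (@pure_linearr k R M (hone H)) \o hautV M.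

Lemma tensH_unitlVE m : tensH_unitlV m = @pureH k H R M (hone H) (hautV M m).
Proof. by []. Qed.

Lemma tensH_unitlVK : cancel tensH_unitlV tensH_unitl.
Proof. by move=> m; rewrite tensH_unitlVE tensH_unitlE lact1 hautVK. Qed.

Lemma tensH_unitlK : cancel tensH_unitl tensH_unitlV.
Proof.
move=> t; tensH_elim t => h m; rewrite tensH_unitlE tensH_unitlVE lact_autV.
(* With [1 = α(1)] the relation can be read backwards: [α(1) ⊗ α⁻¹(h)μ⁻¹(m) = 1α⁻¹(h) ⊗ m = h ⊗
   m]. *)
rewrite -[in LHS](haut_one H) -(pureH_rel (M := R)).
by rewrite [ract R _]hmul1l hautVK.
Qed.

Fact tensH_unitr_balanced : balanced (M := M) (N := R) (fun m h => ract M (m ⊗ h)).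
Proof.
by move=> m g h; rewrite -[h in LHS](hautVK (h := H)) ractA.
Qed.

Definition tensH_unitr_lin : {linear tensH M R -> M} :=
  tensH_lift tensH_unitr_balanced.

Lemma tensH_unitr_linE m (h : R) : tensH_unitr_lin (pureH m h) = ract M (m ⊗ h).
Proof. exact: tensH_liftE. Qed.

Fact tensH_unitr_aut m (h : R) : haut M (tensH_unitr_lin (pureH m h))
  = tensH_unitr_lin (pureH (haut M m) (haut R h)).
Proof. by rewrite !tensH_unitr_linE ract_aut. Qed.

Fact tensH_unitr_lact h m (g : R) :
  tensH_unitr_lin (pureH (lact M (hautV H h ⊗ m)) (haut R g))
  = lact M (h ⊗ tensH_unitr_lin (pureH m g)).
Proof. by rewrite !tensH_unitr_linE lractA hautVK. Qed.

Fact tensH_unitr_ract m (g : R) h :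
  tensH_unitr_lin (pureH (haut M m) (ract R (g ⊗ hautV H h)))
  = ract M (tensH_unitr_lin (pureH m g) ⊗ h).
Proof. by rewrite !tensH_unitr_linE -[ract R _]/(hmul H _) -ractA hautVK. Qed.

Fact tensH_unitr_coact m (h : R) : coact M (tensH_unitr_lin (pureH m h))
  = tmap (hmul H) (tensH_unitr_lin \o tensH_pi M R)
      (tmid _ _ _ _ (coact M m ⊗ coact R h)).
Proof.
rewrite tensH_unitr_linE coact_ract /ract2 -[coact R h]/(hcomul H h).
move: (coact M m) (hcomul H h) => x y.
tensor_elim x => a b; tensor_elim y => c d.
by rewrite !(tmapE, tmidE) /= -!/(pureH _ _) tensH_unitr_linE.
Qed.

Definition tensH_unitr : lcovHom (lcov_tens M R) M :=
  tensH_hom tensH_unitr_aut tensH_unitr_lact tensH_unitr_ract tensH_unitr_coact.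

Lemma tensH_unitrE m (h : R) : tensH_unitr (pureH m h) = ract M (m ⊗ h).
Proof. exact: tensH_unitr_linE. Qed.

Definition tensH_unitrV : {linear M -> lcov_tens M R} :=
  tensH_pi M R \o mklin (@pure_linearl k M R (hone H)) \o hautV M.

Lemma tensH_unitrVE m : tensH_unitrV m = @pureH k H M R (hautV M m) (hone H).
Proof. by []. Qed.

Lemma tensH_unitrVK : cancel tensH_unitrV tensH_unitr.
Proof. by move=> m; rewrite tensH_unitrVE tensH_unitrE ract1 hautVK. Qed.

Lemma tensH_unitrK : cancel tensH_unitr tensH_unitrV.
Proof.
move=> t; tensH_elim t => m h; rewrite tensH_unitrE tensH_unitrVE ract_autV.
by rewrite (pureH_rel (N := R)) [hautV R _]hautV_one [lact R _]hmul1r !hautVK.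
Qed.
End Units.

(** * Naturality, pentagon and triangle *)

Definition lcov_monoidal :
  @monoidal (lcovCat H) lcov_tens (regular H).
Proof.
refine (@Monoidal (lcovCat H) lcov_tens (regular H) tensH_map tensH_assoc
  tensH_unitl tensH_unitr _ _ _ _ _ _ _ _ _ _).
- by move=> M N; apply: tensH_hom_ext => m n; rewrite tensH_mapE.
- move=> M M' M'' N N' N'' f' f g' g; apply: tensH_hom_ext => m n.
  by rewrite /= !tensH_map_linE.
- move=> M M' N N' P P' f g h; apply: tensH_hom_ext => q p.
  rewrite /=; tensH_elim q => m n.
  by rewrite !(tensH_map_linE, tensH_assoc_linE) !lcov_aut lcov_autV.
- move=> M M' f; apply: tensH_hom_ext => h m.
  by rewrite /= tensH_map_linE !tensH_unitl_linE lcov_lact.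
- move=> M M' f; apply: tensH_hom_ext => m h.
  by rewrite /= tensH_map_linE !tensH_unitr_linE lcov_ract.
- move=> M N P; apply: (lcov_iso (g := tensH_assocV M N P)).
    exact: tensH_assocK.
  exact: tensH_assocVK.
- move=> M; apply: (lcov_iso (g := tensH_unitlV M)).
    exact: tensH_unitlK.
  exact: tensH_unitlVK.
- move=> M; apply: (lcov_iso (g := tensH_unitrV M)).
    exact: tensH_unitrK.
  exact: tensH_unitrVK.
- move=> M N P Q; apply: tensH_hom_ext => q z; rewrite /=.
  tensH_elim q => q p; tensH_elim q => m n.
  rewrite !(tensH_map_linE, tensH_assoc_linE).
  (* With [π] and [θ] the automorphisms of [P] and [Q], both paths end at
     [μ²(m) ⊗ (ν(n) ⊗ (π⁻¹(p) ⊗ θ⁻²(z)))], once the automorphisms of the composite objects are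
     expanded factorwise. *)
  rewrite [haut (lcov_tens M N) _]tensH_autE tensH_assoc_linE.
  by rewrite [hautV (lcov_tens P Q) _]tensH_autVE.
- move=> M N; apply: tensH_hom_ext => q n; rewrite /=; tensH_elim q => m h.
  rewrite !(tensH_map_linE, tensH_assoc_linE) tensH_unitlE tensH_unitrE.
  (* The two sides are [μ(m) ⊗ hν⁻¹(n)] and [mh ⊗ n]: the triangle is the defining relation of the
     tensor product over H. *)
  by rewrite pureH_rel.
Defined.
End LeftCovariantTensor.

Theorem theorem4p15 (k : comPzRingType) (H : homHopf k) :
  exists (T : forall M N : lcovBimod H, lcov_struct H (tensH M N))
         (X : @monoidal (lcovCat H) (fun M N => LcovBimod (T M N)) (regular H)),
    let tens (M N : lcovBimod H) : lcovBimod H := LcovBimod (T M N) in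
    [/\ forall (M N : lcovBimod H) (h : H) (m : M) (n : N),
          lact (tens M N) (h ⊗ pureH m n)
          = pureH (lact M (hautV H h ⊗ m)) (haut N n),
        forall (M N : lcovBimod H) (m : M) (n : N) (h : H),
          ract (tens M N) (pureH m n ⊗ h)
          = pureH (haut M m) (ract N (n ⊗ hautV H h)),
        forall (M N : lcovBimod H) (m : M) (n : N),
          coact (tens M N) (pureH m n)
          = tmap (hmul H) (tensH_pi M N) (tmid _ _ _ _ (coact M m ⊗ coact N n)),
        forall (M M' N N' : lcovBimod H) (f : lcovHom M M') (g : lcovHom N N')
               (m : M) (n : N),
          lcov_fun (tensm X f g : lcovHom (tens M N) (tens M' N')) (pureH m n)
          = pureH (f m) (g n)
      & [/\ forall (M N P : lcovBimod H) (m : M) (n : N) (p : P),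
              lcov_fun (associator X M N P
                        : lcovHom (tens (tens M N) P) (tens M (tens N P)))
                (@pureH k H (tens M N) P (pureH m n) p)
              = @pureH k H M (tens N P) (haut M m) (pureH n (hautV P p)),
            forall (M : lcovBimod H) (h : H) (m : M),
              lcov_fun (lunitor X M : lcovHom (tens (regular H) M) M)
                (@pureH k H (regular H) M h m)
              = lact M (h ⊗ m)
          & forall (M : lcovBimod H) (m : M) (h : H),
              lcov_fun (runitor X M : lcovHom (tens M (regular H)) M)
                (@pureH k H M (regular H) m h)
              = ract M (m ⊗ h)]].
Proof.
exists (@lcov_tensH k H), (lcov_monoidal H); split; last split.
- exact: tensH_lactE.
- exact: tensH_ractE.
- exact: tensH_coactE.
- exact: tensH_mapE.
- exact: tensH_assocE.
- exact: tensH_unitlE.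
- exact: tensH_unitrE.
Qed.
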